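(* Let $E$, $X$, $F_t$, $\widehat F_{n,t}$, $\widehat G_t$ and $\widehat P$ be as described in the context (in particular $F_t$ is strictly increasing and continuous for each $t\in E$, and the empirical CLT holds over $\mathcal C$). Let $a_n\to0$, with $a_n\neq0$. Assume that, uniformly in $t\in E$, $\widehat G_t(F_t^{-1}(\alpha))$ is a uniformly continuous function of $\alpha\in(0,1)$, and that, $\widehat P$-almost surely, $$\Big(\sup_{t\in E,x\in\mathbb R}\Big|\frac{\widehat F_{n,t}(x)-F_t(x)}{a_n}-\widehat G_t(x)\Big|\Big)^*\to0\qquad(n\to\infty).$$ Then, setting $I_t(\alpha)=\alpha$ for $t\in E$, $\alpha\in[0,1]$, we have, $\widehat P$-almost surely, $$\Big(\sup_{t\in E,\alpha\in[0,1]}\Big|\frac{(\widehat F_{n,t}\circ F_t^{-1})(\alpha)-I_t(\alpha)}{a_n}-(\widehat G_t\circ F_t^{-1})(\alpha)\Big|\Big)^*\to0$$ and $$\Big(\sup_{t\in E,u\in[0,1]}\Big|\frac{(F_t\circ\widehat F_{n,t}^{-1})(u)-I_t(u)}{a_n}+(\widehat G_t\circ F_t^{-1})(u)\Big|\Big)^*\to0 .$$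
   Context: $E$ is a set, $D(E)$ is a collection of real-valued functions on $E$, and $X=\{X(t):t\in E\}$ is a stochastic process with $P(X(\cdot)\in D(E))=1$. $X_1,X_2,\dots$ are i.i.d. copies of $X$. Put $F(t,x)=F_t(x)=P(X(t)\le x)$, assumed strictly increasing and continuous in $x\in\mathbb R$ for each $t\in E$; $F_n(t,x)=\frac1n\sum_{i=1}^n I(X_i(t)\le x)$, $\nu_n=\sqrt n(F_n-F)$, $C_{t,x}=\{z\in D(E):z(t)\le x\}$, $\mathcal C=\{C_{t,x}:t\in E,x\in\mathbb R\}$ (identified with $E\times\mathbb R$). $\ell_\infty(S)$ is the space of bounded real functions on $S$ with the sup-norm. ''The empirical CLT holds over $\mathcal C$ with limit $G$'' means: there is a centered Gaussian process $G=\{G(t,x)\}$ on $E\times\mathbb R$ with covariance $E(G(s,x)G(t,y))=P(X(s)\le x,X(t)\le y)-F(s,x)F(t,y)$ whose law on $\ell_\infty(E\times\mathbb R)$ is Radon, equivalently whose sample paths are bounded and uniformly continuous with respect to its $L_2$-distance $d((s,x),(t,y))=(E[(G(s,x)-G(t,y))^2])^{1/2}$, and $\lim_n E^*h(\nu_n)=E\,h(G)$ for every bounded continuous $h:\ell_\infty(E\times\mathbb R)\to\mathbb R$ ($E^*$ is upper expectation). $G$ always denotes the version with bounded $d$-uniformly continuous paths. The empirical CLT over $\mathcal C$ is a standing assumption. For a (possibly nonmeasurable) function $f$ with values in $[-\infty,\infty]$ on a probability space, $f^*$ denotes its measurable cover function. Almost sure representation: let $(\Omega,\mathcal A,Q)$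 be the probability space carrying the $X_j$ and $G$. There are a probability space $(\widehat\Omega,\widehat{\mathcal F},\widehat P)$ and perfect measurable maps $g_n:\widehat\Omega\to\Omega$, $n\ge0$ (perfect: $(h\circ g_n)^*=h^*\circ g_n$ a.s. for bounded real $h$ on $\Omega$), with $\widehat P\circ g_n^{-1}=Q$ on $\mathcal A$ for all $n$ and, with $\widehat F_{n,t}(x)=F_n(t,x)\circ g_n$ and $\widehat G_t(x)=\widehat G(t,x)=G(t,x)\circ g_0$, $(\sup_{t,x}|\sqrt n(\widehat F_{n,t}(x)-F_t(x))-\widehat G_t(x)|)^*\to0$ $\widehat P$-a.s. Such a representation is fixed. Inverses: $F_t^{-1}(\alpha)=\inf\{x:F_t(x)\ge\alpha\}$, $\widehat F_{n,t}^{-1}(\alpha)=\inf\{x:\widehat F_{n,t}(x)\ge\alpha\}$. Conventions: $F_t^{-1}(0)=-\infty$, $F_t^{-1}(1)=+\infty$, $F_t(-\infty)=\widehat F_{n,t}(-\infty)=0$, $F_t(+\infty)=\widehat F_{n,t}(+\infty)=1$, $\widehat G_t(\pm\infty)=0$. *)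

(* Defs.v *)
From HB Require Import structures.
From mathcomp Require Import all_boot all_order all_algebra finmap.
From mathcomp Require Import all_classical all_reals all_analysis.
From mathcomp Require Import measurable_realfun.

Set Implicit Arguments.
Unset Strict Implicit.
Unset Printing Implicit Defensive.

Import Order.TTheory GRing.Theory Num.Theory.
Import numFieldNormedType.Exports.

Local Open Scope classical_set_scope.
Local Open Scope ring_scope.

(* [is_mcover P f g]: g is a version of the measurable cover function f^* of
   the possibly nonmeasurable f; it is determined by f up to P-null sets. *)
Definition is_mcover (d : measure_display) (T : measurableType d)
    (R : realType) (P : probability T R) (f g : T -> \bar R) : Prop :=
  [/\ measurable_fun setT g, (forall w, f w <= g w)%E &
      forall h : T -> \bar R, measurable_fun setT h ->
        {ae P, forall w, f w <= h w}%E -> {ae P, forall w, g w <= h w}%E].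

Lemma ereal_rat_between (R : realType) (x y : \bar R) : (x < y)%E ->
  exists q : rat, (x <= (ratr q)%:E /\ (ratr q)%:E < y)%E.
Proof.
move: x y => [x||] [y||] //; rewrite ?lte_fin => xy.
- have [q] := rat_in_itvoo xy; rewrite in_itv/= => /andP[xq qy].
  by exists q; rewrite lee_fin lte_fin ltW.
- have x1 : x < x + 1 by rewrite ltrDl.
  have [q] := rat_in_itvoo x1.
  by rewrite in_itv/= => /andP[xq _]; exists q; rewrite lee_fin ltW ?ltry.
- have y1 : y - 1 < y by rewrite ltrBlDr ltrDl.
  have [q] := rat_in_itvoo y1.
  by rewrite in_itv/= => /andP[_ qy]; exists q; rewrite leNye lte_fin.
- by exists 0; rewrite leNye ltry.
Qed.

Lemma is_mcover_exists (d : measure_display) (T : measurableType d)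
    (R : realType) (P : probability T R) (f : T -> \bar R) :
  exists g, is_mcover P f g.
Proof.
pose Phi := [set u : T -> \bar R |
  measurable_fun setT u /\ forall w, (f w <= u w)%E].
have mlt (u : T -> \bar R) (a : \bar R) :
    measurable_fun setT u -> measurable [set w | (a < u w)%E].
  by move=> mu; rewrite -[X in measurable X]setTI;
    apply: emeasurable_fun_o_infty.
pose m (q : rat) :=
  ereal_inf [set P [set w | ((ratr q)%:E < u w)%E] | u in Phi].
have Phi0 : Phi (cst +oo%E) by split => // w; exact: leey.
have m_fin q : m q \is a fin_num.
  rewrite ge0_fin_numE; last by apply: le_ereal_inf_tmp => _ [u _ <-].
  apply: (@le_lt_trans _ _ 1%E); last exact: ltry.
  apply: ge_ereal_inf; eexists; first by exists (cst +oo%E).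
  by apply: probability_le1; exact: mlt Phi0.1.
have /choice[U HU] (p : rat * nat) : exists u, Phi u /\
    (P [set w | ((ratr p.1)%:E < u w)%E] < m p.1 + (p.2.+1%:R^-1)%:E)%E.
  have e0 : 0 < p.2.+1%:R^-1 :> R by rewrite invr_gt0.
  by have [_ [u Pu <-] lu] := lb_ereal_inf_adherent e0 (m_fin p.1); exists u.
pose dec n : rat * nat := odflt (0, 0%N) (choice.unpickle n).
pose g w := einfs (fun n => U (dec n) w) 0%N.
have gU p w : (g w <= U p w)%E.
  rewrite /g /einfs; apply: ereal_inf_lbound.
  by exists (choice.pickle p) => //=; rewrite /dec choice.pickleK.
have Phig : Phi g.
  split; first by apply: measurable_fun_einfs => n; exact: (HU _).1.1.
  move=> w; apply: le_ereal_inf_tmp => _ [n _ <-]; exact: (HU _).1.2.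
have Pg q : P [set w | ((ratr q)%:E < g w)%E] = m q.
  apply/eqP; rewrite eq_le; apply/andP; split; last first.
    by apply: ereal_inf_lbound; exists g.
  apply/lee_addgt0Pr => e e0.
  have [k ke] : exists k, (k.+1%:R^-1 < e :> R).
    exists (Num.bound e^-1); rewrite invf_plt ?posrE//.
    apply: (lt_trans (archi_boundP _)); first by rewrite invr_ge0 ltW.
    by rewrite ltr_nat.
  apply: (@le_trans _ _ (P [set w | ((ratr q)%:E < U (q, k) w)%E])).
    apply: le_measure; rewrite ?inE; [exact: mlt Phig.1|
      exact: mlt (HU _).1.1|].
    by move=> w /= /lt_le_trans; apply.
  by apply: (le_trans (ltW (HU (q, k)).2)); rewrite leeD2l// lee_fin ltW.
exists g; split; [exact: Phig.1|exact: Phig.2|move=> h mh [N [mN PN0 fN]]].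
pose h' w := mine (g w) (if w \in N then +oo%E else h w).
have mNb : measurable_fun setT (fun w => w \in N : bool).
  by apply: (measurable_fun_bool true); rewrite setTI;
    rewrite (_ : _ @^-1` _ = N)//; apply/seteqP; split=> w; [exact: set_mem|exact: mem_set].
have Ph' : Phi h'.
  split.
    by apply: measurable_mine Phig.1 _; exact: measurable_fun_ifT.
  move=> w; rewrite le_min Phig.2 /=; case: ifPn => [_|/negP wN].
    exact: leey.
  by apply: contrapT => fh; apply/wN/mem_set; exact: fN.
have null q : P ([set w | ((ratr q)%:E < g w)%E] `\`
                 [set w | ((ratr q)%:E < h' w)%E]) = 0.
  have mg := mlt g (ratr q)%:E Phig.1; have mh' := mlt h' (ratr q)%:E Ph'.1.
  rewrite measureD//; last by rewrite (le_lt_trans (probability_le1 _ _)) ?ltry.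
  rewrite setIidr; last by move=> w /=; rewrite lt_min => /andP[].
  rewrite [X in (X - _)%E](_ : _ = P [set w | ((ratr q)%:E < h' w)%E]).
    by rewrite subee// fin_num_measure.
  apply/eqP; rewrite eq_le; apply/andP; split; first by apply: (@le_trans _ _ (m q)); [rewrite -Pg|apply: ereal_inf_lbound; exists h'].
  by apply: le_measure; rewrite ?inE// => w /=; rewrite lt_min => /andP[].
have : P.-negligible (N `|` \bigcup_(n in [set: nat])
    (if choice.unpickle n is Some q then
      [set w | ((ratr q)%:E < g w)%E] `\` [set w | ((ratr q)%:E < h' w)%E]
     else set0)).
  apply: negligibleU; first by exists N; split.
  apply: negligible_bigcup => n; case: (choice.unpickle n) => [q|]; last first.
    exact: negligible_set0.
  have mD := measurableD (mlt g (ratr q)%:E Phig.1) (mlt h' (ratr q)%:E Ph'.1).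
  by apply/(negligibleP _ mD); exact: null.
apply: negligibleS => w /= /negP; rewrite -ltNge => hg.
have [wN|wN] := pselect (N w); first by left.
have [q [hq qg]] := ereal_rat_between hg.
right; exists (choice.pickle q); first exact: I.
rewrite choice.pickleK; split; first exact: qg.
change (~ ((ratr q)%:E < h' w)%E); rewrite /h' ifF; last by apply/negP => /set_mem.
by rewrite lt_min => /andP[_]; rewrite ltNge hq.
Qed.

Definition mcover (d : measure_display) (T : measurableType d)
    (R : realType) (P : probability T R) (f : T -> \bar R) : T -> \bar R :=
  xget (cst +oo%E) [set g | is_mcover P f g].

Lemma mcoverP (d : measure_display) (T : measurableType d)
    (R : realType) (P : probability T R) (f : T -> \bar R) :
  is_mcover P f (mcover P f).
Proof.
rewrite /mcover; case: xgetP => [y _ //|no].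
by have [g /no] := is_mcover_exists P f.
Qed.

Definition mcover_ae_cvg0 (d : measure_display) (T : measurableType d)
    (R : realType) (P : probability T R) (f : nat -> T -> \bar R) : Prop :=
  {ae P, forall w, mcover P (f n) w @[n --> \oo] --> 0%E}.

(* The integral of U is required to exist in [-oo, +oo]. *)
Definition upper_expectation (d : measure_display) (T : measurableType d)
    (R : realType) (P : probability T R) (f : T -> \bar R) : \bar R :=
  ereal_inf [set (\int[P]_w U w)%E | U in [set U : T -> \bar R |
    [/\ measurable_fun setT U, (forall w, f w <= U w)%E &
        (\int[P]_w U^\+ w < +oo)%E \/ (\int[P]_w U^\- w < +oo)%E]]].

Section processes.
Context (R : realType) (E : choiceType).

Definition is_process (d : measure_display) (T : measurableType d)
    (X : T -> E -> R) : Prop :=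
  forall t, measurable_fun setT (X ^~ t).

(* the product sigma-algebra on the path space E -> R *)
Definition path_events : set (set (E -> R)) :=
  <<s [set C | exists t B, measurable B /\ C = [set z : E -> R | B (z t)]] >>.

(* The sequence is indexed from 0: [Xs i] is X_(i+1). *)
Definition iid_copies (D : set (E -> R))
    (d0 : measure_display) (T0 : measurableType d0) (P : probability T0 R)
    (X : T0 -> E -> R)
    (d : measure_display) (T : measurableType d) (Q : probability T R)
    (Xs : nat -> T -> E -> R) : Prop :=
  [/\ forall i, is_process (Xs i),
      forall i, {ae Q, forall w, D (Xs i w)},
      forall i A, path_events A -> Q (Xs i @^-1` A) = P (X @^-1` A) &
      forall (J : {fset nat}) (A : nat -> set (E -> R)),
        (forall i, path_events (A i)) ->
        Q (\bigcap_(i in [set` J]) (Xs i @^-1` A i)) =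
        (\prod_(i <- J) Q (Xs i @^-1` A i))%E].

Definition proc_df (d : measure_display) (T : measurableType d)
    (P : probability T R) (X : T -> E -> R) (t : E) (x : R) : R :=
  fine (P [set w | X w t <= x]).

Definition emp_df (T : Type) (Xs : nat -> T -> E -> R) (n : nat) (w : T)
    (t : E) (x : R) : R :=
  n%:R^-1 * \sum_(i < n) (Xs i w t <= x)%R%:R.

Definition emp_process (T : Type) (Xs : nat -> T -> E -> R)
    (F : E -> R -> R) (n : nat) (w : T) (p : E * R) : R :=
  Num.sqrt n%:R * (emp_df Xs n w p.1 p.2 - F p.1 p.2).

(* l_infty(E x R), as a (clopen) subset of the space of all functions with the
   topology of uniform convergence. *)
Definition linf : set {uniform (E * R)%type -> R} := bounded_fun.

Definition linf_borel : set (set {uniform (E * R)%type -> R}) :=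
  [set B | B `<=` linf /\ <<s @open {uniform (E * R)%type -> R} >> B].

End processes.

(* [normal_prob 0 0] is not the point mass at 0, hence the separate
   degenerate case. *)
Definition centered_normal (R : realType) (d : measure_display)
    (T : measurableType d) (Q : probability T R) (Z : T -> R) : Prop :=
  {ae Q, forall w, Z w = 0} \/
  exists2 s : R, 0 < s &
    forall B, measurable B -> Q (Z @^-1` B) = normal_prob 0 s B.

Definition centered_gaussian (R : realType) (S : Type) (d : measure_display)
    (T : measurableType d) (Q : probability T R) (G : T -> S -> R) : Prop :=
  (forall p, measurable_fun setT (G ^~ p)) /\
  forall (m : nat) (c : 'I_m -> R) (p : 'I_m -> S),
    centered_normal Q (fun w => \sum_(i < m) c i * G w (p i)).

Definition L2_dist (R : realType) (S : Type) (d : measure_display)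
    (T : measurableType d) (Q : probability T R) (G : T -> S -> R)
    (p q : S) : R :=
  Num.sqrt (fine ('E_Q[(fun w => (G w p - G w q) ^+ 2)%R])%E).

Definition radon_law (R : realType) (E : choiceType) (d : measure_display)
    (T : measurableType d) (Q : probability T R)
    (G : T -> (E * R)%type -> R) : Prop :=
  (forall B, @linf_borel R E B -> measurable (G @^-1` B)) /\
  forall B, @linf_borel R E B -> forall e : R, 0 < e ->
    exists K : set {uniform (E * R)%type -> R},
      [/\ compact K, K `<=` B & (Q (G @^-1` (B `\` K)) <= e%:E)%E].

(* The limit process G is the version all of whose paths are bounded and
   uniformly continuous for its L2-distance. *)
Definition empirical_CLT (R : realType) (E : choiceType)
    (d0 : measure_display) (T0 : measurableType d0) (P : probability T0 R)
    (X : T0 -> E -> R)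
    (d : measure_display) (T : measurableType d) (Q : probability T R)
    (Xs : nat -> T -> E -> R) (G : T -> (E * R)%type -> R) : Prop :=
  let F := proc_df P X in
  [/\ centered_gaussian Q G,
      forall s x t y, ('E_Q[(fun w => G w (s, x) * G w (t, y))%R])%E =
        (P [set w | (X w s <= x)%R /\ (X w t <= y)%R] - (F s x * F t y)%R%:E)%E,
      (forall w, linf (G w)) /\
      (forall w (e : R), 0 < e -> exists2 r : R, 0 < r &
        forall p q, L2_dist Q G p q < r -> `|G w p - G w q| < e),
      radon_law Q G &
      forall h : {uniform (E * R)%type -> R} -> R,
        {within @linf R E, continuous h} ->
        (exists M, forall z, linf z -> `|h z| <= M) ->
        upper_expectation Q (fun w => (h (emp_process Xs F n w))%:E)
          @[n --> \oo] --> ('E_Q[fun w => h (G w)])%E].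

Definition perfect (R : realType)
    (dh : measure_display) (Th : measurableType dh) (Ph : probability Th R)
    (d : measure_display) (T : measurableType d) (Q : probability T R)
    (g : Th -> T) : Prop :=
  forall h : T -> R, (exists M, forall w, `|h w| <= M) ->
    {ae Ph, forall w, mcover Ph (fun v => (h (g v))%:E) w =
                      mcover Q (fun v => (h v)%:E) (g w)}.

Section representation.
Context (R : realType) (E : choiceType).
Context (T Th : Type) (Xs : nat -> T -> E -> R) (G : T -> (E * R)%type -> R).
Context (g : nat -> Th -> T).

Definition Fhat (n : nat) (w : Th) (t : E) (x : R) : R :=
  emp_df Xs n (g n w) t x.

Definition Ghat (w : Th) (t : E) (x : R) : R := G (g 0%N w) (t, x).

End representation.

Definition as_representation (R : realType) (E : choiceType)
    (F : E -> R -> R)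
    (d : measure_display) (T : measurableType d) (Q : probability T R)
    (Xs : nat -> T -> E -> R) (G : T -> (E * R)%type -> R)
    (dh : measure_display) (Th : measurableType dh) (Ph : probability Th R)
    (g : nat -> Th -> T) : Prop :=
  [/\ forall n, measurable_fun setT (g n),
      forall n, perfect Ph Q (g n),
      forall n A, measurable A -> Ph (g n @^-1` A) = Q A &
      mcover_ae_cvg0 Ph (fun n w => ereal_sup
        [set `|Num.sqrt n%:R * (Fhat Xs g n w t x - F t x) - Ghat G g w t x|%:E
        | t in [set: E] & x in [set: R]])].

(* The infimum is taken in the extended reals, so that it is -oo at a = 0 and
   +oo when no x satisfies a <= H x; for a continuous strictly increasing
   distribution function this yields -oo at 0 and +oo at 1. *)
Definition inv_df (R : realType) (H : R -> R) (a : R) : \bar R :=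
  ereal_inf [set x%:E | x in [set x | a <= H x]].

Definition ext_df (R : realType) (H : R -> R) (x : \bar R) : R :=
  match x with r%:E => H r | +oo%E => 1 | -oo%E => 0 end.

Definition ext0 (R : realType) (H : R -> R) (x : \bar R) : R :=
  match x with r%:E => H r | _ => 0 end.

(* Main.v *)
Require Import Defs.
From HB Require Import structures.
From mathcomp Require Import all_boot all_order all_algebra.
From mathcomp Require Import all_classical all_reals all_analysis.
From mathcomp Require Import measurable_realfun ring lra.
Set Implicit Arguments.
Unset Strict Implicit.
Unset Printing Implicit Defensive.
Import Order.TTheory GRing.Theory Num.Theory.
Import numFieldNormedType.Exports.
Local Open Scope classical_set_scope.
Local Open Scope ring_scope.

(** The first claim is a change of variables: every [u] in the open unit
interval is [F_t x] for the real number [x = F_t^{-1}(u)], and at [u = 0, 1]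
both terms vanish, so the new supremum is at most the given one.

For the second claim fix [t], [n], a sample point and [u > 0], and let [y] be
the [u]-quantile of the empirical distribution function [H]. Since [H] is
within [|a| e] of the continuous function [F + a G] everywhere, and [H] crosses
the level [u] at [y], letting the argument tend to [y] from both sides gives
[|F y + a G y - u| <= |a| e]; jumps of [H] need no separate treatment
([quantile_deviation]). So [(F y - u) / a] is within [e] of [- G y], and it
remains to compare [G y] with [G (F^{-1} u)]. For [e < 1] the same bound gives
[|F y - u| < |a| (1 + |G y|)], which is small because [G] is bounded and [a]
tends to [0], and [G o F^{-1}] is uniformly continuous. At [u = 1] the value
[G (F^{-1} u)] is [0] by convention, and the comparison requires [G] to vanish
at [+oo]. This follows from the hypothesis: for each fixed [n] the quotient
[(H - F) / a] vanishes at [+oo], and [G] is a uniform limit of such quotients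
([uniform_limit_vanishes]). [inverse_deviation] gathers all this.

The suprema need not be measurable, so pointwise convergence does not suffice
for their measurable covers. By [mcover_ae_cvg0_events] it is enough that, for
each [e], the [n]-th supremum is at most [e] on a measurable event, and that
almost every sample point belongs to all but finitely many of these events. The
event used requires that the cover of the given deviation is small and that
[|G x - G y| <= e] whenever [|F x - F y| < |a_n| (1 + |G y|)]. The second
requirement fails on an open set of paths ([open_oscillation]), and preimages of
open sets of paths under [G] are measurable because its law is Radon on
[l_infty] ([measurable_radon_open]). *)

(** * Quantiles of a perturbed distribution function *)

Section quantiles.
Variable R : realType.
Implicit Types (F G H : R -> R) (a e u x y : R).

Lemma inv_df_strict F x : {homo F : x y / x < y} -> inv_df F (F x) = x%:E.
Proof.
move=> F_lt; apply/eqP; rewrite eq_le; apply/andP; split.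
  by apply: ereal_inf_lbound; exists x => /=.
apply: le_ereal_inf_tmp => _ [y /= Fxy <-]; rewrite lee_fin.
by apply: contraTT Fxy; rewrite -!ltNge => /F_lt.
Qed.

Lemma inv_df0 H : (forall x, 0 <= H x) -> inv_df H 0 = -oo%E.
Proof.
move=> H_ge0; apply: eq_ninfty => x.
by apply: ereal_inf_lbound; exists x => /=.
Qed.

Lemma inv_df1 F : (forall x, F x < 1) -> inv_df F 1 = +oo%E.
Proof.
move=> F_lt1; rewrite /inv_df (_ : [set x | _] = set0) ?image_set0 ?ereal_inf0//.
by apply/seteqP; split=> // x /=; rewrite leNgt F_lt1.
Qed.

Lemma inv_df_real H u : {homo H : x y / x <= y} ->
    (exists x, H x < u) -> (exists x, u <= H x) ->
  exists y, [/\ inv_df H u = y%:E, forall x, x < y -> H x < u &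
                forall x, y < x -> u <= H x].
Proof.
move=> H_le [x1 Hx1] [x2 Hx2].
have finv : inv_df H u \is a fin_num.
  rewrite fin_numE -ltNye -ltey; apply/andP; split.
    apply: lt_le_trans (ltNyr x1) _; apply: le_ereal_inf_tmp => _ [y /= uy <-].
    rewrite lee_fin; apply: contraTT uy; rewrite -!ltNge => /ltW /H_le.
    by move=> /le_lt_trans; apply.
  by apply: (@le_lt_trans _ _ x2%:E); rewrite ?ltry//;
    apply: ereal_inf_lbound; exists x2 => /=.
exists (fine (inv_df H u)); split=> [|x xy|x yx]; first by rewrite fineK.
  rewrite ltNge; apply: contraTN xy => uHx; rewrite -leNgt -lee_fin fineK//.
  by apply: ereal_inf_lbound; exists x => /=.
have [//|Hx_lt] := leP u (H x).
suff : (x%:E <= inv_df H u)%E by rewrite -(fineK finv) lee_fin leNgt yx.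
apply: le_ereal_inf_tmp => _ [z /= uz <-]; rewrite lee_fin leNgt.
apply: contraTN uz => /ltW /H_le zx; rewrite -ltNge.
exact: le_lt_trans zx Hx_lt.
Qed.

(** [H] crosses the level [u] at [y] and stays within [|a| e] of [F + a G]. The
one-sided limits at [y] are taken of the continuous [F + a G] and not of [H],
so a jump of [H] at [y] does not enter the bound. *)
Lemma quantile_deviation F G H a e u y : a != 0 ->
    {for y, continuous F} -> {for y, continuous G} ->
    (forall x, `|(H x - F x) / a - G x| <= e) ->
    (forall x, x < y -> H x < u) -> (forall x, y < x -> u <= H x) ->
  `|(F y - u) / a + G y| <= e.
Proof.
move=> a0 Fc Gc He Hlt Hge.
pose phi x := F x + a * G x.
have phi_y : phi x @[x --> y] --> phi y.
  by apply: cvgD Fc _; apply: cvgM => //; exact: cvg_cst.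
have Hphi x : `|H x - phi x| <= `|a| * e.
  have -> : H x - phi x = a * ((H x - F x) / a - G x) by rewrite /phi; field.
  by rewrite normrM ler_pM.
have lo : u - `|a| * e <= phi y.
  apply: (cvgr_to_ge (cvg_at_right_filter phi_y)); near=> x.
  have yx : y < x by near: x; exact: nbhs_right_gt.
  by have := Hge x yx; have := Hphi x; rewrite ler_norml => /andP[]; lra.
have hi : phi y <= u + `|a| * e.
  apply: (cvgr_to_le (cvg_at_left_filter phi_y)); near=> x.
  have xy : x < y by near: x; exact: nbhs_left_lt.
  by have := Hlt x xy; have := Hphi x; rewrite ler_norml => /andP[]; lra.
have -> : (F y - u) / a + G y = (phi y - u) / a by rewrite /phi; field.
rewrite normrM normfV ler_pdivrMr ?normr_gt0// mulrC.
by rewrite ler_norml; apply/andP; split; lra.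
Unshelve. all: by end_near. Qed.

Lemma strict_df_itv F x : {homo F : x y / x < y} ->
  F x @[x --> -oo%R] --> (0 : R) -> F x @[x --> +oo%R] --> (1 : R) -> 0 < F x < 1.
Proof.
move=> F_lt F0 F1; apply/andP; split.
  have xm : x - 1 < x by rewrite ltrBlDr ltrDl.
  apply: le_lt_trans (F_lt _ _ xm); apply: (cvgr_to_le F0).
  near=> y; apply: ltW; apply: F_lt; near: y; exact: nbhs_ninfty_lt (num_real _).
have xp : x < x + 1 by rewrite ltrDl.
apply: lt_le_trans (F_lt _ _ xp) _; apply: (cvgr_to_ge F1).
near=> y; apply: ltW; apply: F_lt; near: y; exact: nbhs_pinfty_gt (num_real _).
Unshelve. all: by end_near. Qed.

Lemma strict_df_quantile F u : continuous F ->
  F x @[x --> -oo%R] --> (0 : R) -> F x @[x --> +oo%R] --> (1 : R) -> 0 < u < 1 ->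
  exists x, F x = u.
Proof.
move=> Fc F0 F1 /andP[u0 u1].
have [x [Fx x0]] : exists x, F x < u /\ x <= 0.
  have FN : \forall x \near -oo%R, F x < u /\ x <= 0.
    near=> x; split; near: x; [exact: cvgr_lt _ F0 _ u0|].
    exact: nbhs_ninfty_le (num_real _).
  by have [x ?] := filter_ex FN; exists x.
have [y [Fy y0]] : exists y, u < F y /\ 0 <= y.
  have FN : \forall x \near +oo%R, u < F x /\ 0 <= x.
    near=> z; split; near: z; [exact: cvgr_gt _ F1 _ u1|].
    exact: nbhs_pinfty_ge (num_real _).
  by have [y ?] := filter_ex FN; exists y.
have xy : x <= y by exact: le_trans y0.
have uF : Num.min (F x) (F y) <= u <= Num.max (F x) (F y).
  by rewrite ge_min le_max (ltW Fx) (ltW Fy) orbT.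
have [c _ <-] := IVT xy (continuous_subspaceT Fc) uF.
by exists c.
Unshelve. all: by end_near. Qed.

(** The oscillation hypothesis is stated at exactly the scale
[|a| (1 + |G y|)] that [quantile_deviation] provides for [|F y - u|]. The bound
on [G] thus stays out of the statement, and the hypothesis is a condition on
[G] alone. *)
Lemma inverse_deviation F G H a e u :
    {homo F : x y / x < y} -> continuous F ->
    F x @[x --> -oo%R] --> (0 : R) -> F x @[x --> +oo%R] --> (1 : R) ->
    continuous G -> G x @[x --> +oo%R] --> (0 : R) ->
    {homo H : x y / x <= y} -> (forall x, 0 <= H x) ->
    (exists x, H x = 0) -> (exists x, H x = 1) ->
    a != 0 -> e < 1 -> (forall x, `|(H x - F x) / a - G x| <= e) ->
    (forall x y, `|F x - F y| < `|a| * (1 + `|G y|) -> `|G x - G y| <= e) ->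
    0 <= u <= 1 ->
  `|(ext_df F (inv_df H u) - u) / a + ext0 G (inv_df F u)| <= e + e.
Proof.
move=> F_lt Fc F0 F1 Gc G0 H_le H_ge0 [x0 Hx0] [x1 Hx1] a0 e1 He osc.
move=> /andP[u_ge0 u_le1].
have e_ge0 : 0 <= e := le_trans (normr_ge0 _) (He 0).
have a_gt0 : 0 < `|a| by rewrite normr_gt0.
have F01 x := strict_df_itv x F_lt F0 F1.
have F_lt1 x : F x < 1 by have /andP[] := F01 x.
have [u0|u_gt0] := eqVneq u 0.
  rewrite u0 !inv_df0//; last by move=> x; have /andP[/ltW] := F01 x.
  by rewrite /= subrr mul0r addr0 normr0 addr_ge0.
have {u_gt0 u_ge0} u_gt0 : 0 < u by rewrite lt_def u_gt0.
have [y [-> Hlt Hge]] : exists y, [/\ inv_df H u = y%:E,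
    forall x, x < y -> H x < u & forall x, y < x -> u <= H x].
  by apply: inv_df_real => //; [exists x0; rewrite Hx0|exists x1; rewrite Hx1].
have dev := quantile_deviation a0 (Fc y) (Gc y) He Hlt Hge.
have Fyu : `|F y - u| < `|a| * (1 + `|G y|).
  rewrite -[F y - u](divfK a0) normrM mulrC ltr_pM2l//.
  rewrite -[_ / a](addrK (G y)); apply: le_lt_trans (ler_normB _ _) _.
  by rewrite ltrD2r; exact: le_lt_trans e1.
suff Gyu : `|ext0 G (inv_df F u) - G y| <= e.
  rewrite /= -[ext0 _ _](subrK (G y)) addrCA addrC.
  by apply: le_trans (ler_normD _ _) _; rewrite lerD.
have [u1|u_neq1] := eqVneq u 1; last first.
  have u01 : 0 < u < 1 by rewrite u_gt0 lt_neqAle u_neq1.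
  have [x Fx] := strict_df_quantile Fc F0 F1 u01.
  by rewrite -Fx inv_df_strict//= osc// Fx distrC.
(* At [u = 1] compare [G y] with [G x] for [x] tending to [+oo]: then
   [F y < F x < 1], so [F x] is even closer to [F y] than [1] is. *)
rewrite u1 inv_df1//= sub0r normrN.
have GN : `|G x - G y| @[x --> +oo%R] --> `|0 - G y|.
  by apply: cvg_norm; apply: cvgB => //; exact: cvg_cst.
rewrite -[`|G y|]normrN -sub0r; apply: (cvgr_to_le GN).
near=> x; apply: osc; apply: le_lt_trans Fyu; rewrite u1.
have Fyx : F y < F x by apply: F_lt; near: x; exact: nbhs_pinfty_gt (num_real _).
have Fx1 := F_lt1 x; have Fy1 := F_lt1 y.
by rewrite ger0_norm ?subr_ge0 1?ltW// distrC ger0_norm ?subr_ge0 1?ltW ?ltrD2r.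
Unshelve. all: by end_near. Qed.

(** Each quotient [(H - F) / a] vanishes at [+oo], where [H] and [F] have the same
limit, and this passes to their uniform limit. *)
Lemma uniform_limit_vanishes F G : F x @[x --> +oo%R] --> (1 : R) ->
    (forall e, 0 < e -> exists H a, H x @[x --> +oo%R] --> (1 : R) /\
      forall x, `|(H x - F x) / a - G x| <= e) ->
  G x @[x --> +oo%R] --> (0 : R).
Proof.
move=> F1 approx; apply/cvgrPdist_le => e e0.
have e20 : 0 < e / 2 by rewrite divr_gt0.
have [H [a [H1 He]]] := approx _ e20.
have D0 : (H x - F x) / a @[x --> +oo%R] --> (0 : R).
  by rewrite -(mul0r a^-1) -(subrr 1); apply: cvgM;
    [exact: cvgB|exact: cvg_cst].
move/cvgrPdist_le : D0 => /(_ _ e20); apply: filterS => x.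
by have := He x; rewrite !ler_norml => /andP[? ?] /andP[? ?];
  apply/andP; split; lra.
Qed.

End quantiles.

(** * True and empirical distribution functions *)

Section distribution_functions.
Variables (R : realType) (E : choiceType).

Lemma cvg_proc_df (d : measure_display) (T : measurableType d)
    (P : probability T R) (X : T -> E -> R) (t : E) : is_process X ->
  proc_df P X t x @[x --> -oo%R] --> (0 : R) /\
  proc_df P X t x @[x --> +oo%R] --> (1 : R).
Proof.
move=> /(_ t) mXt.
pose Y : {RV P >-> R} := mfun_Sub (mem_set mXt : (X ^~ t) \in mfun).
have dfE : proc_df P X t = fine \o cdf Y.
  apply/funext => x /=; rewrite /proc_df /cdf /distribution /pushforward.
  by congr (fine (P _)); apply/seteqP; split=> w /=; rewrite in_itv.
by rewrite dfE; split; apply: fine_cvg; [exact: cvg_cdfNy0|exact: cvg_cdfy1].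
Qed.

Variables (T : Type) (Xs : nat -> T -> E -> R) (n : nat) (w : T) (t : E).

Lemma emp_df_ge0 x : 0 <= emp_df Xs n w t x.
Proof. by rewrite mulr_ge0 ?invr_ge0// sumr_ge0. Qed.

Lemma emp_df_homo : {homo emp_df Xs n w t : x y / x <= y}.
Proof.
move=> x y xy; rewrite /emp_df ler_wpM2l ?invr_ge0// ler_sum// => i _.
rewrite ler_nat; case: leP => // Xx.
by rewrite (le_trans Xx xy).
Qed.

Let range_le (i : 'I_n) : `|Xs i w t| <= \sum_(j < n) `|Xs j w t|.
Proof. by rewrite (bigD1 i)//= lerDl sumr_ge0. Qed.

Lemma emp_df_eq0 : exists x, emp_df Xs n w t x = 0.
Proof.
exists (- (\sum_(j < n) `|Xs j w t|) - 1); rewrite /emp_df big1 ?mulr0// => i _.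
have := range_le i; rewrite ler_norml => /andP[Xi _].
suff /negbTE -> : ~~ (Xs i w t <= - (\sum_(j < n) `|Xs j w t|) - 1) by [].
by rewrite -ltNge; lra.
Qed.

Lemma emp_df_near1 : (0 < n)%N -> \forall x \near +oo%R, emp_df Xs n w t x = 1.
Proof.
move=> n0; near=> x; rewrite /emp_df (eq_bigr (fun=> 1)) => [|i _].
  by rewrite sumr_const card_ord mulVf// pnatr_eq0 -lt0n.
suff -> : Xs i w t <= x by [].
apply: le_trans (ler_norm _) (le_trans (range_le i) _).
by near: x; exact: nbhs_pinfty_ge (num_real _).
Unshelve. all: by end_near. Qed.

End distribution_functions.

(** * Almost sure convergence of measurable covers *)

Section measurable_covers.
Variable R : realType.

Lemma cvge0P (u : nat -> \bar R) : (forall n, 0 <= u n)%E ->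
  (forall e : R, 0 < e -> \forall n \near \oo, (u n <= e%:E)%E) ->
  u n @[n --> \oo] --> 0%E.
Proof.
move=> u_ge0 u_le; apply/fine_cvgP; split.
  apply: filterS (u_le 1 ltr01) => n un.
  by rewrite ge0_fin_numE// (le_lt_trans un) ?ltry.
apply/cvgrPdist_le => e /u_le; apply: filterS => n un.
rewrite /= sub0r normrN ger0_norm ?fine_ge0//.
by rewrite -lee_fin fineK// ge0_fin_numE// (le_lt_trans un) ?ltry.
Qed.

Lemma ereal_sup_norm_ge0 (I J : Type) (A : set I) (B : set J) (f : I -> J -> R)
    i j : A i -> B j ->
  (0 <= ereal_sup [set `|f x y|%:E | x in A & y in B])%E.
Proof.
move=> Ai Bj; apply: (@le_trans _ _ `|f i j|%:E); first by rewrite lee_fin.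
by apply: ereal_sup_ubound; exists i => //; exists j.
Qed.

Lemma cvge0_lt (u : nat -> \bar R) : u n @[n --> \oo] --> 0%E ->
  forall e : R, 0 < e -> \forall n \near \oo, (u n < e%:E)%E.
Proof.
move=> u0 e e0; move: u0 => /(_ [set x | (x < e%:E)%E]); apply.
by apply: open_nbhs_nbhs; split; [exact: open_ereal_lt_ereal|rewrite /= lte_fin].
Qed.

Context (d : measure_display) (T : measurableType d) (P : probability T R).

(** The function equal to [e] on [A n] and to [+oo] elsewhere is measurable and
dominates [f n], hence also its cover, almost surely. Letting [e] run over the
inverses of the integers keeps the exceptional set negligible. *)
Lemma mcover_ae_cvg0_events (f : nat -> T -> \bar R) :
  (forall n w, 0 <= f n w)%E ->
  (forall e : R, 0 < e -> exists A : nat -> set T,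
    [/\ forall n, measurable (A n),
        {ae P, forall w, \forall n \near \oo, A n w} &
        {ae P, forall w, forall n, A n w -> (f n w <= e%:E)%E}]) ->
  mcover_ae_cvg0 P f.
Proof.
move=> f_ge0 fA.
have e_gt0 m : 0 < m.+1%:R^-1 :> R by rewrite invr_gt0.
have /choice[A HA] m := fA _ (e_gt0 m).
pose h m n w : \bar R := if w \in A m n then (m.+1%:R^-1)%:E else +oo%E.
have cover_le : {ae P, forall w m n, (mcover P (f n) w <= h m n w)%E}.
  apply: ae_foralln => m; apply: ae_foralln => n.
  have [mA _ fle] := HA m; have [_ _ mc_le] := mcoverP P (f n); apply: (mc_le (h m n)).
    have mAn : measurable_fun setT (fun w => w \in A m n : bool).
      apply: (measurable_fun_bool true); rewrite setTI.
      by rewrite (_ : _ @^-1` _ = A m n)//; apply/seteqP; split=> w;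
        [exact: set_mem|exact: mem_set].
    exact: measurable_fun_ifT.
  apply: filterS fle => w fw; rewrite /h; case: ifPn => [/set_mem|_].
    exact: fw.
  by rewrite leey.
have evA : {ae P, forall w m, \forall n \near \oo, A m n w}.
  by apply: ae_foralln => m; have [] := HA m.
apply: filterS2 cover_le evA => w hw Aw; apply: cvge0P => [n|e e0].
  have [_ f_le _] := mcoverP P (f n); exact: le_trans (f_ge0 n w) (f_le w).
have [m me] : exists m, (m.+1%:R^-1 < e :> R).
  exists (Num.bound e^-1); rewrite invf_plt ?posrE//.
  apply: (lt_trans (archi_boundP _)); first by rewrite invr_ge0 ltW.
  by rewrite ltr_nat.
apply: filterS (Aw m) => n Anw; apply: le_trans (hw m n) _.
by rewrite /h mem_set// lee_fin ltW.
Qed.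

Lemma mcover_ae_cvg0_lt (f : nat -> T -> \bar R) : mcover_ae_cvg0 P f ->
  forall e : R, 0 < e ->
  {ae P, forall w, \forall n \near \oo, (mcover P (f n) w < e%:E)%E}.
Proof.
by move=> f0 e e0; apply: filterS f0 => w /cvge0_lt; apply.
Qed.

(** This excludes an empty index set, over which a supremum is [-oo]. *)
Lemma mcover_ae_cvg0_neqNy (f : nat -> T -> \bar R) : mcover_ae_cvg0 P f ->
  exists n w, f n w != -oo%E.
Proof.
move=> f0; apply: contrapT => fNy.
have cNy : {ae P, forall w n, (mcover P (f n) w <= -oo)%E}.
  apply: ae_foralln => n; have [_ _ mc_le] := mcoverP P (f n).
  apply: (mc_le (cst -oo%E)) => //.
  apply: nearW => w; rewrite leeNy_eq.
  by have [//|fn] := eqVneq (f n w) -oo%E; exfalso; apply: fNy; exists n, w.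
have PP : ProperFilter (almost_everywhere P).
  have P_gt0 : (0 < P setT)%E by rewrite probability_setT.
  exact: ae_properfilter_algebraOfSetsType P_gt0.
have [w [w0 wNy]] := filter_ex (filterI f0 cNy).
suff : (0%R%:E <= -oo :> \bar R)%E by [].
by apply: (cvge_to_le w0); exact: nearW.
Qed.

End measurable_covers.

(** * Measurable events of a random path with Radon law *)

Section radon_limit.
Variables (R : realType) (E : choiceType).
Notation path := {uniform (E * R)%type -> R}.

Lemma continuous_eval (p : E * R) : continuous (fun z : path => z p).
Proof.
move=> z; have FF : Filter (nbhs z) by exact: nbhs_filter.
apply/cvgrPdist_lt => e e0; apply/uniform_nbhs.
exists [set xy | `|xy.1 - xy.2| < e]; split; first exact: entourage_ball (PosNum e0).
by move=> z' /(_ p I).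
Qed.

Lemma linfP (z : path) : linf z <-> exists M, forall p, `|z p| <= M.
Proof.
rewrite /linf /= /bounded_near; split=> [zb|[M zM]].
  by have [M zM] := filter_ex zb; exists M => p; exact: zM.
near=> K => p _ /=; apply: le_trans (zM p) _.
by near: K; exact: nbhs_pinfty_ge (num_real _).
Unshelve. all: by end_near. Qed.

Lemma open_linf : open (@linf R E).
Proof.
rewrite openE => z /linfP[M zM]; apply/uniform_nbhs.
exists [set xy | `|xy.1 - xy.2| < 1]; split; first exact: entourage_ball (PosNum ltr01).
move=> z' zz'; apply/linfP; exists (M + 1) => p /=.
have := zz' p I; have /= := zM p => zp /= zz'p.
rewrite -[z' p](subrK (z p)); apply: le_trans (ler_normD _ _) _.
by rewrite addrC lerD// distrC ltW.
Qed.

(** The two inequalities are strict and each involves finitely many coordinates,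
which are continuous for uniform convergence; the existential quantifiers make
this set a union of open sets. *)
Lemma open_oscillation (F : E -> R -> R) (c e : R) :
  open [set z : path | exists t x y,
    `|F t x - F t y| < c * (1 + `|z (t, y)|) /\ e < `|z (t, x) - z (t, y)|].
Proof.
have -> : [set z : path | exists t x y,
    `|F t x - F t y| < c * (1 + `|z (t, y)|) /\ e < `|z (t, x) - z (t, y)|] =
  \bigcup_(q in [set: E * (R * R)])
    ([set z : path | `|F q.1 q.2.1 - F q.1 q.2.2| < c * (1 + `|z (q.1, q.2.2)|)]
     `&` [set z : path | e < `|z (q.1, q.2.1) - z (q.1, q.2.2)|]).
  apply/seteqP; split=> [z [t [x [y ?]]]|z [[t [x y]] _ /= ?]].
    by exists (t, (x, y)).
  by exists t, x, y.
apply: bigcup_open => -[t [x y]] _ /=; apply: openI.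
  apply: (@open_comp _ _ (fun z : path => c * (1 + `|z (t, y)|))
    [set r | `|F t x - F t y| < r]).
    move=> z _; have FF : Filter (nbhs z) by exact: nbhs_filter.
    apply: cvgM; first exact: cvg_cst.
    by apply: cvgD; [exact: cvg_cst|apply: cvg_norm; exact: continuous_eval].
  exact: open_gt.
apply: (@open_comp _ _ (fun z : path => `|z (t, x) - z (t, y)|)
  [set r | e < r]).
  move=> z _; have FF : Filter (nbhs z) by exact: nbhs_filter.
  by apply: cvg_norm; apply: cvgB; exact: continuous_eval.
exact: open_gt.
Qed.

(** The law of [G] only sees Borel subsets of [linf]; as [linf] is open, cutting
an open set down to it costs nothing. *)
Lemma measurable_radon_open (d : measure_display) (T : measurableType d)
    (Q : probability T R) (G : T -> (E * R)%type -> R) (O : set path) :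
  radon_law Q G -> (forall w, linf (G w)) -> open O -> measurable (G @^-1` O).
Proof.
move=> [mG _] Glinf Oo.
have -> : G @^-1` O = G @^-1` (O `&` @linf R E).
  by apply/seteqP; split=> [w Ow|w []//]; split=> //; exact: Glinf.
apply: mG; split=> [z []//|]; apply: sub_sigma_algebra.
by apply: openI => //; exact: open_linf.
Qed.

End radon_limit.

(** * Convergence of the empirical and quantile deviations *)

Theorem lemma2 (R : realType) (E : choiceType) (D : set (E -> R))
    (d0 : measure_display) (T0 : measurableType d0) (P : probability T0 R)
    (X : T0 -> E -> R)
    (d : measure_display) (T : measurableType d) (Q : probability T R)
    (Xs : nat -> T -> E -> R) (G : T -> (E * R)%type -> R)
    (dh : measure_display) (Th : measurableType dh) (Ph : probability Th R)
    (g : nat -> Th -> T) (a : nat -> R) :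
  let F := proc_df P X in
  let Fh := Fhat Xs g in
  let Gh := Ghat G g in
  is_process X ->
  {ae P, forall w, D (X w)} ->
  iid_copies D P X Q Xs ->
  (forall t, {homo F t : x y / x < y}) ->
  (forall t, continuous (F t)) ->
  empirical_CLT P X Q Xs G ->
  as_representation F Q Xs G Ph g ->
  a @ \oo --> 0 ->
  (forall n, (0 < n)%N -> a n != 0) ->
  {ae Ph, forall w, forall e : R, 0 < e -> exists2 r : R, 0 < r &
    forall (t : E) (u v : R), 0 < u < 1 -> 0 < v < 1 -> `|u - v| < r ->
      `|ext0 (Gh w t) (inv_df (F t) u) - ext0 (Gh w t) (inv_df (F t) v)| < e} ->
  mcover_ae_cvg0 Ph (fun n w => ereal_sup
    [set `|(Fh n w t x - F t x) / a n - Gh w t x|%:E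
    | t in [set: E] & x in [set: R]]) ->
  mcover_ae_cvg0 Ph (fun n w => ereal_sup
    [set `|(ext_df (Fh n w t) (inv_df (F t) u) - u) / a n
           - ext0 (Gh w t) (inv_df (F t) u)|%:E
    | t in [set: E] & u in `[0, 1]]) /\
  mcover_ae_cvg0 Ph (fun n w => ereal_sup
    [set `|(ext_df (F t) (inv_df (Fh n w t) u) - u) / a n
           + ext0 (Gh w t) (inv_df (F t) u)|%:E
    | t in [set: E] & u in `[0, 1]]).
Proof.
move=> F Fh Gh mX _ _ F_lt Fc [_ _ [Glinf _] radonG _] [mg _ _ _] a0 an0 Guc devG.
have F0 t := (cvg_proc_df P t mX).1; have F1 t := (cvg_proc_df P t mX).2.
have F01 t x := strict_df_itv x (F_lt t) (F0 t) (F1 t).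
have invF t x : inv_df (F t) (F t x) = x%:E by exact: inv_df_strict (F_lt t).
have invF0 t : inv_df (F t) 0 = -oo%E.
  by apply: inv_df0 => x; have /andP[/ltW] := F01 t x.
have invF1 t : inv_df (F t) 1 = +oo%E.
  by apply: inv_df1 => x; have /andP[] := F01 t x.
(* Over an empty [E] the hypothesis would be about the constant [-oo]. An index
   is needed for the two suprema in the conclusion to be nonnegative. *)
have [t0 _] : exists t : E, True.
  have [n [w]] := mcover_ae_cvg0_neqNy devG; apply: contraNP => E0.
  rewrite (_ : [set _ | _ in _ & _ in _] = set0) ?ereal_sup0//.
  by apply/seteqP; split=> // y [t _ _]; exfalso; apply: E0; exists t.
move: devG; set dev := (X in mcover_ae_cvg0 Ph X) => devG.
have dev_le n w e : (mcover Ph (dev n) w < e%:E)%E ->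
    forall t x, `|(Fh n w t x - F t x) / a n - Gh w t x| <= e.
  move=> we t x; rewrite -lee_fin; apply: le_trans (ltW we).
  have [_ dev_mc _] := mcoverP Ph (dev n); apply: le_trans (dev_mc w).
  by apply: ereal_sup_ubound; exists t => //; exists x.
have measurable_dev n e : measurable [set w | (mcover Ph (dev n) w < e%:E)%E].
  have [mdev _ _] := mcoverP Ph (dev n).
  by rewrite -[X in measurable X]setTI; apply: emeasurable_fun_infty_o.
split; apply: mcover_ae_cvg0_events => [n w|e e0].
- by apply: (@ereal_sup_norm_ge0 _ _ _ _ _ _ t0 0) => //=; rewrite in_itv/= lexx ler01.
- exists (fun n => [set w | (mcover Ph (dev n) w < e%:E)%E]); split=> //.
    exact: mcover_ae_cvg0_lt.
  apply: nearW => w n /= /dev_le we; apply: ge_ereal_sup => _ [t _ [u + <-]].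
  rewrite /= in_itv/= lee_fin => /andP[u_ge0 u_le1].
  have [->|u0] := eqVneq u 0.
    by rewrite invF0 /= subrr mul0r subr0 normr0 ltW.
  have [->|u1] := eqVneq u 1.
    by rewrite invF1 /= subrr mul0r subr0 normr0 ltW.
  have u01 : 0 < u < 1 by rewrite !lt_neqAle eq_sym u0 u1 u_ge0.
  have [x <-] := strict_df_quantile (Fc t) (F0 t) (F1 t) u01.
  by rewrite invF; exact: we.
- by apply: (@ereal_sup_norm_ge0 _ _ _ _ _ _ t0 0) => //=; rewrite in_itv/= lexx ler01.
(* [inverse_deviation] yields the bound [e' + e'] and requires [e' < 1]. *)
pose e' := Num.min (e / 2) 2^-1.
have e'0 : 0 < e' by rewrite lt_min divr_gt0//= invr_gt0.
have e'1 : e' < 1 by rewrite gt_min; apply/orP; right; lra.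
have e'e : e' + e' <= e.
  have : e' <= e / 2 by rewrite ge_min lexx.
  by lra.
pose osc n := [set z : {uniform (E * R)%type -> R} | exists t x y,
  `|F t x - F t y| < `|a n| * (1 + `|z (t, y)|) /\
  e' < `|z (t, x) - z (t, y)|].
have Guc_F : {ae Ph, forall w, forall e : R, 0 < e -> exists2 r : R, 0 < r &
    forall t x y, `|F t x - F t y| < r -> `|Gh w t x - Gh w t y| < e}.
  apply: filterS Guc => w Gw e1 /Gw[r r0 Gr]; exists r => // t x y.
  by move=> /(Gr t _ _ (F01 t x) (F01 t y)); rewrite !invF.
exists (fun n => [set w | (0 < n)%N] `&`
  ([set w | (mcover Ph (dev n) w < e'%:E)%E] `&`
   g 0%N @^-1` (~` (G @^-1` osc n)))); split.
- move=> n; apply: measurableI.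
    by case: (0 < n)%N; rewrite ?set_true ?set_false.
  apply: measurableI => //; rewrite -[X in measurable X]setTI; apply: mg => //.
  apply: measurableC; apply: (measurable_radon_open radonG Glinf).
  exact: open_oscillation.
(* Almost every point is eventually in the event: [|a n| (1 + M)], with [M] a
   bound of [G], falls below the modulus of continuity attached to [e']. *)
- have dev_lt := mcover_ae_cvg0_lt devG e'0.
  apply: filterS2 dev_lt Guc_F => w dev_w Gw.
  have [r r0 Gr] := Gw _ e'0.
  have /linfP[M GM] := Glinf (g 0%N w).
  have small : \forall n \near \oo, `|a n| * (1 + M) < r.
    have : `|a n| * (1 + M) @[n --> \oo] --> (0 : R).
      by rewrite -(mul0r (1 + M)) -(@normr0 _ R); apply: cvgM;
        [exact: cvg_norm|exact: cvg_cst].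
    by move=> /cvgr_lt; apply.
  near=> n; split; first by near: n; exact: nbhs_infty_gt.
  split; first by near: n.
  move=> -[t [x [y [Fxy]]]]; apply/negP; rewrite -leNgt; apply: ltW; apply: Gr.
  apply: (lt_trans Fxy); apply: le_lt_trans (_ : `|a n| * (1 + M) < r).
    by rewrite ler_wpM2l// lerD2l.
  by near: n.
apply: filterS2 devG Guc_F => w dev0 Gw n [n0 [/dev_le devn oscn]].
have oscG t x y : `|F t x - F t y| < `|a n| * (1 + `|Gh w t y|) ->
    `|Gh w t x - Gh w t y| <= e'.
  move=> Fxy; rewrite leNgt; apply/negP => Gxy.
  by apply: oscn; exists t, x, y.
apply: ge_ereal_sup => _ [t _ [u + <-]].
rewrite /= in_itv/= lee_fin => u01; apply: le_trans e'e.
have Gc : continuous (Gh w t).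
  move=> y; apply/cvgrPdist_lt => e1 /Gw[r r0 Gr].
  have /cvgrPdist_lt/(_ _ r0) := Fc t y.
  by apply: filterS => x; exact: Gr.
have G0 : Gh w t x @[x --> +oo%R] --> (0 : R).
  apply: uniform_limit_vanishes (F1 t) _ => e1 e10.
  have dev1 : \forall m \near \oo, (mcover Ph (dev m) w < e1%:E)%E.
    exact: cvge0_lt.
  have [m [m0 /dev_le devm]] := filter_ex (filterI (nbhs_infty_gt 0) dev1).
  exists (Fh m w t), (a m); split=> //.
  by apply: cvg_near_cst; exact: emp_df_near1.
apply: inverse_deviation => //.
- exact: emp_df_homo.
- exact: emp_df_ge0.
- exact: emp_df_eq0.
- by have [x Hx] := filter_ex (emp_df_near1 Xs (g n w) t n0); exists x.
- exact: an0.
- exact: oscG.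
Unshelve. all: by end_near. Qed.
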